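(* Let $\mathcal{GO}$ be a bivariate general overlap function, let $N$ be a strict fuzzy negation, and let $I_{\mathcal{GO}}^{N}(x,y)=N(\mathcal{GO}(x,N(y)))$ for $x,y\in[0,1]$. If $I_{\mathcal{GO}}^{N}$ satisfies (IB) and $\mathcal{GO}$ has $1$ as neutral element, then $N$ is strong and $\mathcal{GO}$ is idempotent.
   Context: A fuzzy negation is a map $N:[0,1]\to[0,1]$ with $N(0)=1$, $N(1)=0$ and $N(x)\le N(y)$ whenever $y\le x$. It is strict if it is continuous and $N(x)<N(y)$ whenever $y<x$; it is strong if $N(N(x))=x$ for all $x\in[0,1]$. A bivariate general overlap function is a function $\mathcal{GO}:[0,1]^2\to[0,1]$ such that for all $x,y\in[0,1]$: (1) $\mathcal{GO}(x,y)=\mathcal{GO}(y,x)$; (2) if $xy=0$ then $\mathcal{GO}(x,y)=0$; (3) if $xy=1$ then $\mathcal{GO}(x,y)=1$; (4) $\mathcal{GO}$ is increasing (in the non-strict sense) in each variable; (5) $\mathcal{GO}$ is continuous. An element $a\in[0,1]$ is a neutral element of $\mathcal{GO}$ if $\mathcal{GO}(x,a)=x$ for all $x\in[0,1]$. $\mathcal{GO}$ is idempotent if $\mathcal{GO}(x,x)=x$ for all $x\in[0,1]$. A function $I:[0,1]^2\to[0,1]$ satisfies (IB) (iterative Boolean law) if $I(x,I(x,y))=I(x,y)$ for all $x,y\in[0,1]$. *)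

(* Defs.v *)
From HB Require Import structures.
From mathcomp Require Import all_boot all_order all_algebra.
From mathcomp Require Import all_classical all_reals all_analysis.

Set Implicit Arguments.
Unset Strict Implicit.
Unset Printing Implicit Defensive.

Import Order.TTheory GRing.Theory Num.Theory.
Import numFieldNormedType.Exports.

Local Open Scope classical_set_scope.
Local Open Scope ring_scope.

(* Maps [0,1] -> [0,1] and [0,1]^2 -> [0,1] are encoded as total maps on R that
   send the unit interval (square) into the unit interval; every condition only
   concerns arguments in [0,1], and continuity refers to the subspace topology,
   so the values outside are irrelevant. *)

Record fuzzy_negation (R : realType) (N : R -> R) : Prop := FuzzyNegation {
  fuzzy_negation_itv : forall x : R, x \in `[0, 1] -> N x \in `[0, 1];
  fuzzy_negation0 : N 0 = 1;
  fuzzy_negation1 : N 1 = 0;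
  fuzzy_negation_anti :
    forall x y : R, x \in `[0, 1] -> y \in `[0, 1] -> y <= x -> N x <= N y
}.

Record strict_fuzzy_negation (R : realType) (N : R -> R) : Prop :=
  StrictFuzzyNegation {
  strict_fuzzy_negationW : fuzzy_negation N;
  strict_fuzzy_negation_continuous : {within `[0, 1], continuous N};
  strict_fuzzy_negation_anti :
    forall x y : R, x \in `[0, 1] -> y \in `[0, 1] -> y < x -> N x < N y
}.

Record strong_fuzzy_negation (R : realType) (N : R -> R) : Prop :=
  StrongFuzzyNegation {
  strong_fuzzy_negationW : fuzzy_negation N;
  strong_fuzzy_negationK : forall x : R, x \in `[0, 1] -> N (N x) = x
}.

Record general_overlap (R : realType) (GO : R -> R -> R) : Prop :=
  GeneralOverlap {
  general_overlap_itv : forall x y : R,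
    x \in `[0, 1] -> y \in `[0, 1] -> GO x y \in `[0, 1];
  general_overlapC : forall x y : R,
    x \in `[0, 1] -> y \in `[0, 1] -> GO x y = GO y x;
  general_overlap0 : forall x y : R,
    x \in `[0, 1] -> y \in `[0, 1] -> x * y = 0 -> GO x y = 0;
  general_overlap1 : forall x y : R,
    x \in `[0, 1] -> y \in `[0, 1] -> x * y = 1 -> GO x y = 1;
  general_overlap_homol : forall x x' y : R,
    x \in `[0, 1] -> x' \in `[0, 1] -> y \in `[0, 1] ->
    x <= x' -> GO x y <= GO x' y;
  general_overlap_homor : forall x y y' : R,
    x \in `[0, 1] -> y \in `[0, 1] -> y' \in `[0, 1] ->
    y <= y' -> GO x y <= GO x y';
  general_overlap_continuous :
    {within `[0, 1] `*` `[0, 1], continuous (fun p : R * R => GO p.1 p.2)}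
}.

Definition neutral_element (R : realType) (GO : R -> R -> R) (a : R) : Prop :=
  a \in `[0, 1] /\ forall x : R, x \in `[0, 1] -> GO x a = x.

Definition idempotent_overlap (R : realType) (GO : R -> R -> R) : Prop :=
  forall x : R, x \in `[0, 1] -> GO x x = x.

Definition iterative_boolean (R : realType) (I : R -> R -> R) : Prop :=
  forall x y : R, x \in `[0, 1] -> y \in `[0, 1] -> I x (I x y) = I x y.

Definition overlap_implication (R : realType) (GO : R -> R -> R) (N : R -> R)
  (x y : R) : R := N (GO x (N y)).

(* Main.v *)
Require Import Defs.
From HB Require Import structures.
From mathcomp Require Import all_boot all_order all_algebra.
From mathcomp Require Import all_classical all_reals all_analysis.

(** Write I for the implication built from GO and N.  Since 1 is neutral,
    I(1, y) = N (N y), so the Boolean law at x = 1 says that N o N is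
    idempotent; as N is injective ([strict_fuzzy_negation_inj]), N o N is the
    identity.  Since N 0 = 1, neutrality also gives I(x, 0) = N x; once N is
    involutive, the Boolean law at y = 0 becomes N (GO x x) = N x, and
    injectivity yields GO x x = x. *)

Import Order.TTheory GRing.Theory Num.Theory.
Local Open Scope ring_scope.

Lemma strict_fuzzy_negation_inj (R : realType) (N : R -> R) :
  strict_fuzzy_negation N -> {in `[0, 1] &, injective N}.
Proof.
move=> hN x y x01 y01 Nxy.
by have [xy|yx|//] := ltgtP x y;
  [have := strict_fuzzy_negation_anti hN y01 x01 xy
  |have := strict_fuzzy_negation_anti hN x01 y01 yx]; rewrite Nxy ltxx.
Qed.

Theorem proposition16 (R : realType) (GO : R -> R -> R) (N : R -> R)
  (hGO : general_overlap GO) (hN : strict_fuzzy_negation N)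
  (hIB : iterative_boolean (overlap_implication GO N))
  (hneutral : neutral_element GO (1%R : R)) :
  strong_fuzzy_negation N /\ idempotent_overlap GO.
Proof.
have [i01 GOx1] := hneutral.
have hNW := strict_fuzzy_negationW hN.
have N01 := fuzzy_negation_itv hNW.
have Ninj := strict_fuzzy_negation_inj _ _ hN.
have o01 : (0 : R) \in `[0, 1] by rewrite in_itv /= lexx ler01.
have GO1x x : x \in `[0, 1] -> GO 1 x = x.
  by move=> x01; rewrite (general_overlapC hGO) ?GOx1.
have NK x : x \in `[0, 1] -> N (N x) = x.
  move=> x01; have := hIB _ _ i01 x01.
  rewrite /overlap_implication !GO1x ?N01 // => NNNN.
  have Nx01 := N01 _ x01; have NNx01 := N01 _ Nx01.
  have NNNx01 := N01 _ NNx01.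
  exact: (Ninj _ _ NNx01 x01 (Ninj _ _ NNNx01 Nx01 NNNN)).
split; first by split.
move=> x x01; have := hIB _ _ x01 o01.
rewrite /overlap_implication (fuzzy_negation0 hNW) !GOx1 ?NK //.
by apply: (Ninj) => //; apply: (general_overlap_itv hGO).
Qed.
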